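(* Let $p \geq 5$ be a prime, and let $a, b \in \mathbb{F}_p$. Then (i) $\displaystyle\sum_{t\in\mathbb{F}_{p}} a_{p,\,t,\,b}= -p\left(\frac{b}{p}\right)$; (ii) $\displaystyle\sum_{t \in \mathbb{F}_{p}} a_{p,\,a,\,t}= 0$.
   Context: $\mathbb{F}_p$ is the field with $p$ elements and $\left(\frac{\cdot}{p}\right)$ is the Legendre symbol modulo $p$, with $\left(\frac{0}{p}\right)=0$. For $a,b\in\mathbb{F}_p$, let $E_{a,b}$ be the curve $y^2=x^3+ax+b$ over $\mathbb{F}_p$, and define the integer $a_{p,\,a,\,b}$ by $\#E_{a,b}(\mathbb{F}_p)=p+1-a_{p,\,a,\,b}$ (points counted including the one point at infinity); equivalently $a_{p,\,a,\,b}=-\sum_{x\in\mathbb{F}_p}\left(\frac{x^3+ax+b}{p}\right)$. This formula is used for all pairs $(a,b)$, including those with $4a^3+27b^2=0$. *)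

(* Defs.v *)
From mathcomp Require Import all_boot all_order all_algebra.

Set Implicit Arguments.
Unset Strict Implicit.
Unset Printing Implicit Defensive.

Import GRing.Theory.
Local Open Scope ring_scope.

Definition legendre (p : nat) (x : 'F_p) : int :=
  if x == 0 then 0
  else if [exists y : 'F_p, y ^+ 2 == x] then 1 else -1.

(* The F_p-points of y^2 = x^3 + a x + b; [None] is the point at infinity.
   The curve may be singular: no condition is put on 4 a^3 + 27 b^2. *)
Definition curve_points (p : nat) (a b : 'F_p) : {set option ('F_p * 'F_p)} :=
  [set P | if P is Some (x, y) then y ^+ 2 == x ^+ 3 + a * x + b else true].

(* The integer a_{p,a,b} such that #E_{a,b}(F_p) = p + 1 - a_{p,a,b}. *)
Definition trace_Frob (p : nat) (a b : 'F_p) : int :=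
  p%:Z + 1 - #|curve_points a b|%:Z.

Arguments legendre p x : clear implicits.
Arguments curve_points p a b : clear implicits.
Arguments trace_Frob p a b : clear implicits.

(* Main.v *)
Require Import Defs.
From mathcomp Require Import all_boot all_order all_algebra.
From mathcomp Require Import ring.

(** Both sums count the triples (t, x, y) on the curves of a pencil, and the
    equation y^2 = x^3 + t x + b (resp. y^2 = x^3 + a x + t) has degree one in
    the parameter t. Hence it is enough to fix (x, y) and count the t
    ([sum_trace_Frob]): as soon as the coefficient of t is nonzero, the right
    side is an injective function of t, hence a permutation of the field, and
    there is exactly one t ([card_inj_fiber]).

    In the second pencil the coefficient is 1, so there are p^2 affine points
    in all, an average of p per curve, and the traces cancel. In the first
    pencil the coefficient is x. The line x = 0 is exceptional: there the
    equation is y^2 = b for every t, which has 1 + (b/p) solutions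
    ([card_sqrt]). This line thus carries p (1 + (b/p)) triples instead of p,
    and the excess p (b/p) is, up to sign, the sum of the traces. *)

Set Implicit Arguments.
Unset Strict Implicit.
Unset Printing Implicit Defensive.

Import GRing.Theory.
Local Open Scope ring_scope.

Lemma card_inj_fiber (T : finType) (f : T -> T) (c : T) :
  injective f -> #|[set t | c == f t]| = 1%N.
Proof.
case/injF_bij=> g fK gK; rewrite -(cards1 (g c)); apply: eq_card => t.
by rewrite !inE eq_sym (can2_eq fK gK).
Qed.

(** A nonzero square has exactly the roots z and - z, which are distinct
    because p is odd. *)
Lemma card_sqrt (p : nat) (b : 'F_p) : prime p -> (2 < p)%N ->
  #|[set y : 'F_p | y ^+ 2 == b]|%:Z = 1 + legendre p b.
Proof.
move=> p_prime p_gt2; rewrite /legendre.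
have [->|b0] := eqVneq b 0.
  have -> : [set y : 'F_p | y ^+ 2 == 0] = [set 0].
    by apply/setP => y; rewrite !inE expf_eq0.
  by rewrite cards1 addr0.
case: existsP => [[z /eqP zb]|no_root]; last first.
  rewrite subrr; congr Posz; apply: eq_card0 => y.
  by rewrite inE; apply/negP => yb; apply: no_root; exists y.
have z0 : z != 0 by apply: contraNneq b0 => z0; rewrite -zb z0 expr0n.
have two0 : 2%:R != 0 :> 'F_p.
  by rewrite -(dvdn_pcharf (pchar_Fp p_prime)) gtnNdvd.
have -> : [set y : 'F_p | y ^+ 2 == b] = [set z; - z].
  by apply/setP => y; rewrite !inE -zb eqf_sqr.
by rewrite cards2 -addr_eq0 -mulr2n -mulr_natr mulf_neq0.
Qed.

Lemma trace_FrobE (p : nat) (a b : 'F_p) :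
  trace_Frob p a b =
  p%:Z - (\sum_(z : 'F_p * 'F_p) (z.2 ^+ 2 == z.1 ^+ 3 + a * z.1 + b)%R)%N%:Z.
Proof.
rewrite /trace_Frob.
pose A := [set z : 'F_p * 'F_p | z.2 ^+ 2 == z.1 ^+ 3 + a * z.1 + b].
have -> : (\sum_z (z.2 ^+ 2 == z.1 ^+ 3 + a * z.1 + b)%R)%N = #|A|.
  by rewrite -sum1dep_card [RHS]big_mkcond.
have -> : curve_points p a b = None |: Some @: A.
  apply/setP => -[[x y]|]; rewrite !inE //=.
  by rewrite mem_imset ?inE // => ? ? [].
rewrite cardsU1 card_imset; last by move=> ? ? [].
have -> : (None \notin Some @: A) by apply/imsetP => -[].
by rewrite PoszD /= opprD addrA addrK.
Qed.

(** The double count: the roles of the parameter and of the point are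
    exchanged, so that a sum of traces is read off from the number of
    parameters t whose curve passes through a given (x, y). *)
Lemma sum_trace_Frob (p : nat) (u v : 'F_p -> 'F_p) : prime p ->
  \sum_t trace_Frob p (u t) (v t) =
  p%:Z * p%:Z
  - (\sum_x \sum_y #|[set t | (y ^+ 2 == x ^+ 3 + u t * x + v t)%R]|)%N%:Z.
Proof.
move=> p_prime; under [LHS]eq_bigr => t _ do rewrite trace_FrobE.
rewrite sumrB sumr_const card_Fp // -mulr_natr natz; congr (_ - _).
rewrite -(big_morph Posz PoszD (erefl _)) [X in Posz X = _]exchange_big.
congr Posz; rewrite [RHS]pair_bigA; apply: eq_bigr => z _.
by rewrite -sum1dep_card [RHS]big_mkcond.
Qed.

Theorem theorem3 (p : nat) (p_prime : prime p) (p_ge5 : (5 <= p)%N)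
    (a b : 'F_p) :
  (\sum_(t : 'F_p) trace_Frob p t b = - p%:Z * legendre p b) /\
  (\sum_(t : 'F_p) trace_Frob p a t = 0).
Proof.
have sum1_Fp : (\sum_(y : 'F_p) 1 = p)%N by rewrite sum1_card card_Fp.
split; rewrite sum_trace_Frob //.
  (* The line x = 0 is set apart: t drops out of the equation there. *)
  rewrite (bigD1 0) //=.
  have -> : (\sum_(y : 'F_p) #|[set t : 'F_p | (y ^+ 2 == 0 ^+ 3 + t * 0 + b)%R]|
             = p * #|[set y : 'F_p | (y ^+ 2 == b)%R]|)%N.
    rewrite -[X in (X * _)%N]card_Fp // mulnC -sum_nat_const.
    rewrite [RHS]big_mkcond; apply: eq_bigr => y _.
    rewrite inE; case: ifP => yb.
      by apply: eq_card => t; rewrite !inE expr0n mulr0 !add0r yb.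
    by apply: eq_card0 => t; rewrite !inE expr0n mulr0 !add0r yb.
  have -> : (\sum_(x | x != 0%R) \sum_y
              #|[set t : 'F_p | (y ^+ 2 == x ^+ 3 + t * x + b)%R]|
             = p.-1 * p)%N.
    rewrite (eq_bigr (fun=> p)) => [|x x0].
      by rewrite sum_nat_const cardC1 card_Fp.
    apply: etrans sum1_Fp; apply: eq_bigr => y _.
    by apply: card_inj_fiber => s t /addIr/addrI/(mulIf x0).
  rewrite PoszD !PoszM card_sqrt ?(leq_trans _ p_ge5) //.
  by rewrite -subn1 -subzn ?prime_gt0 //; ring.
rewrite (eq_bigr (fun=> p)) => [|x _].
  by rewrite sum_nat_const card_Fp // PoszM subrr.
apply: etrans sum1_Fp; apply: eq_bigr => y _.
by apply: card_inj_fiber => s t /addrI.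
Qed.
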